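(* For all $n\in\mathbb{Z}^+$, the map $\lambda_n:\mathscr{L}_n\to\mathscr{O}_n$ is a bijection.
   Context: An ordered set partition of $[n]=\{1,\dots,n\}$ is a sequence $(B_1,\dots,B_k)$ of pairwise disjoint nonempty subsets (blocks) whose union is $[n]$. $\mathscr{L}_n$ is the set of ordered set partitions of $[n]$ with an even number of blocks. Define the cyclic predecessor relation on $[n]$ by $a\prec a+1$ for $1\le a<n$, and $n\prec 1$. An ordered set partition has no cyclical adjacencies if no block contains two elements $a,b$ with $a\prec b$. Equivalently, for $1\le j\le n-1$, $j$ and $j+1$ lie in different blocks, and $1$ and $n$ lie in different blocks. $\mathscr{O}_n$ is the set of ordered set partitions of $[n]$ with no cyclical adjacencies. The map $\lambda_n$ is defined as follows. Take $\mathbf{B}=(B_1,\dots,B_{2k})\in\mathscr{L}_n$ and start with $B_{2k+1}=\emptyset$. For each $i=1,\dots,2k$ and each maximal chain $j_1\prec j_2\prec\cdots\prec j_t$ ($t\ge 2$) of cyclically consecutive elements all lying in $B_i$, remove from $B_i$ the elements $j_2,j_4,\dots,j_{\gamma(t)}$ and put them into $B_{2k+1}$. Here $\gamma(t)=t$ if $t$ is even and $\gamma(t)=t-1$ if $t$ is odd. Then $\lambda_n(\mathbf{B})=(B_1,\dots,B_{2k},B_{2k+1})$, using the modified blocks, with the last block omitted if it is empty. *)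

(* Defs.v *)
From mathcomp Require Import all_boot.

Set Implicit Arguments.
Unset Strict Implicit.
Unset Printing Implicit Defensive.

(* The ground set [n] = {1, ..., n} is 'I_n, with i : 'I_n standing for i + 1. *)

Definition is_osp (n : nat) (s : seq {set 'I_n}) : bool :=
  [&& set0 \notin s,
      pairwise (fun A B : {set 'I_n} => [disjoint A & B]) s
    & \bigcup_(A <- s) A == [set: 'I_n]].

(* For n = 1 this gives 0 ≺ 0. *)
Definition cprec (n : nat) : rel 'I_n := fun a b =>
  (b == a.+1 :> nat) || ((a.+1 == n) && (b == 0 :> nat)).

(* a and b are not required to be distinct, so that "1 and n lie in different
   blocks" fails when n = 1. *)
Definition no_cyc_adj (n : nat) (s : seq {set 'I_n}) : bool :=
  all (fun B : {set 'I_n} =>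
         [forall a in B, forall b in B, ~~ cprec a b]) s.

Definition Lset (n : nat) : pred (seq {set 'I_n}) :=
  fun s => is_osp s && ~~ odd (size s).

Definition Oset (n : nat) : pred (seq {set 'I_n}) :=
  fun s => is_osp s && no_cyc_adj s.

Definition is_chain (n : nat) (B : {set 'I_n}) (s : seq 'I_n) : bool :=
  [&& sorted (@cprec n) s, uniq s & all (fun x => x \in B) s].

Definition is_max_chain (n : nat) (B : {set 'I_n}) (s : seq 'I_n) : bool :=
  is_chain B s &&
  [forall a, ~~ is_chain B (a :: s) && ~~ is_chain B (rcons s a)].

Definition gamma (t : nat) : nat := if odd t then t.-1 else t.

(* The elements j_2, j_4, ..., j_gamma(t) of the maximal chains
   j_1 ≺ ... ≺ j_t, t >= 2, of B; j_(k+1) is tnth j k. A chain has no repeated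
   element, so t <= n. *)
Definition removed (n : nat) (B : {set 'I_n}) : {set 'I_n} :=
  [set x | [exists t : 'I_n.+1, exists j : t.-tuple 'I_n,
     [&& 2 <= t, is_max_chain B j &
         [exists k : 'I_t,
            [&& ~~ odd k.+1, k.+1 <= gamma t & x == tnth j k]]]]].

Definition lambda (n : nat) (s : seq {set 'I_n}) : seq {set 'I_n} :=
  let s' := [seq B :\: removed B | B <- s] in
  let last_block := \bigcup_(B <- s) removed B in
  if last_block == set0 then s' else rcons s' last_block.

(* Main.v *)
(* Let p be the cyclic predecessor. A block B of an element of L_n is a proper
   subset of the circle, because a block equal to [n] would be the only one. For
   proper B, the removed set is the unique Q such that x is in Q iff x and p x
   are in B and p x is not in Q: the recursion along p is well founded since it
   leaves B. Hence the predecessor of a removed element is a kept element of the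
   same block, so the inverse of lambda moves each element x of the last block R
   (present iff the number of blocks is odd) back to the block containing p x.
   By the uniqueness of Q, the elements moved back are exactly those which lambda
   removes again. *)

Require Import Defs.
From mathcomp Require Import all_boot.

Set Implicit Arguments.
Unset Strict Implicit.
Unset Printing Implicit Defensive.

(** * The circle as an orbit of [ordS], and positions counted from the start of a chain *)

Lemma cprecE n (a b : 'I_n) : cprec a b = (ordS a == b).
Proof.
rewrite /cprec -val_eqE /=.
have [ltan|geqan] := ltnP a.+1 n.
  by rewrite modn_small // (ltn_eqF ltan) /= orbF eq_sym.
have eqan : a.+1 = n by apply/eqP; rewrite eqn_leq geqan ltn_ord.
rewrite eqan eqxx modnn /= [0 == _]eq_sym orb_idl // => /eqP eqbn.
by have := ltn_ord b; rewrite eqbn ltnn.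
Qed.

Lemma iter_ordS_val n i (x : 'I_n) : iter i (@ordS n) x = (x + i) %% n :> nat.
Proof.
elim: i => [|i IHi]; first by rewrite addn0 modn_small.
by rewrite /= IHi -addn1 modnDml addn1 addnS.
Qed.

Lemma iter_ordS_reach n (x y : 'I_n) : exists i, iter i (@ordS n) x = y.
Proof.
(* From [x], [n - x] steps lead round to 0, and [y] more lead to [y]. *)
exists (n - x + y); apply: val_inj => /=.
by rewrite iter_ordS_val addnA subnKC ?modnDl ?modn_small // ltnW.
Qed.

Lemma iter_ordSK n i : cancel (iter i (@ordS n)) (iter i (@ord_pred n)).
Proof.
by elim: i => // i IHi x; rewrite iterSr [iter _ (@ordS n) _]iterS ordSK.
Qed.

(** The backward orbit of [x] runs through the whole circle. *)
Lemma ord_pred_closed_setT n (B : {set 'I_n}) x :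
  x \in B -> (forall y, y \in B -> ord_pred y \in B) -> B = setT.
Proof.
move=> Bx Bp; apply/setP => y; rewrite inE.
have [i iyx] := iter_ordS_reach y x.
by rewrite -(iter_ordSK i y) iyx; apply: iter_in.
Qed.

(* [offset B k x]: the maximal chain of B through x starts k steps before x. *)
Fixpoint offset n (B : {set 'I_n}) k x :=
  (x \in B) && (if k is k'.+1 then offset B k' (ord_pred x)
                else ord_pred x \notin B).

Lemma offset_in n (B : {set 'I_n}) k x : offset B k x -> x \in B.
Proof. by case: k => [|k] /andP[]. Qed.

Lemma offset_uniq n (B : {set 'I_n}) k l x :
  offset B k x -> offset B l x -> k = l.
Proof.
elim: k l x => [|k IHk] [|l] x //= /andP[_ ox] /andP[_ ox'].
- by rewrite (offset_in ox') in ox.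
- by rewrite (offset_in ox) in ox'.
- by rewrite (IHk _ _ ox ox').
Qed.

(** Walking back from [x] eventually meets a point outside [B]; the number of steps taken before the
    first exit is the offset. *)
Lemma offset_ex n (B : {set 'I_n}) x :
  B != setT -> x \in B -> exists k, offset B k x.
Proof.
rewrite -subTset => /subsetPn[y _ nBy] Bx.
have [i iyx] := iter_ordS_reach y x.
have {y nBy iyx}: iter i (@ord_pred n) x \notin B by rewrite -iyx iter_ordSK.
elim: i x Bx => [|i IHi] x Bx; first by rewrite /= Bx.
rewrite iterSr; have [Bpx /(IHi _ Bpx)[k ok]|npx _] := boolP (ord_pred x \in B).
  by exists k.+1; rewrite /= Bx.
by exists 0; rewrite /= Bx.
Qed.

(** * Maximal chains and the parity description of the removed set *)

Lemma sorted_cprec n (s : seq 'I_n) :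
  sorted (@cprec n) s = sorted (frel (@ordS n)) s.
Proof. by case: s => //= x s; apply: eq_path => a b; rewrite cprecE. Qed.

(** If the predecessor of [y] were in [B], maximality would force it to occur in the chain already.
    The chain would then close up to the whole circle inside [B]. *)
Lemma max_chain_start n (B : {set 'I_n}) y s :
  B != setT -> is_max_chain B (y :: s) -> ord_pred y \notin B.
Proof.
move=> nBT /andP[/and3P[srt us Bs] /forallP mx]; apply: contra nBT => Bpy.
have /andP[] := mx (ord_pred y); rewrite sorted_cprec in srt.
move: us Bs srt; rewrite /is_chain sorted_cprec /=.
move=> us Bs fp; rewrite fp us Bs Bpy ord_predK eqxx /= !andbT negbK => spy _.
have /fpathP[m sE] := fp; rewrite -subTset.
rewrite -(@ord_pred_closed_setT n [set x in y :: s] y) ?inE ?eqxx //.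
  by apply/subsetP => x; rewrite !inE => /predU1P[->|/(allP (andP Bs).2)//];
     case/andP: Bs.
move=> x; rewrite !inE => /predU1P[->//|]; rewrite sE => /trajectP[i ltim ->].
rewrite -iterSr iterS ordSK -in_cons -trajectS; apply/trajectP.
by exists i; rewrite // ltnW.
Qed.

Lemma chain_offset n (B : {set 'I_n}) y k :
  ord_pred y \notin B -> (forall i, i <= k -> iter i (@ordS n) y \in B) ->
  offset B k (iter k (@ordS n) y).
Proof.
move=> npy; elim: k => [|k IHk] By /=; first by rewrite npy (By 0).
by rewrite ordSK (By k.+1) // IHk // => i leik; rewrite By // leqW.
Qed.

(** A maximal chain starts where the circle enters [B], so zero-based indices in it are offsets. *)
Lemma max_chain_offset n (B : {set 'I_n}) x0 s k :
  B != setT -> is_max_chain B s -> k < size s -> offset B k (nth x0 s k).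
Proof.
move=> nBT; case: s => // y s mxs ltks; have npy := max_chain_start nBT mxs.
have /andP[/and3P[+ _ /allP Bs] _] := mxs.
rewrite sorted_cprec => /fpathP[m sE]; move: ltks Bs {mxs}.
rewrite sE -trajectS size_traject => ltkm Bs.
rewrite (set_nth_default y) ?size_traject // nth_traject //.
apply: chain_offset => // i leik; apply: Bs; apply/trajectP.
by exists i => //; apply: leq_ltn_trans ltkm.
Qed.

Lemma offset_chain n (B : {set 'I_n}) x k : offset B k x ->
  exists y, [/\ x = iter k (@ordS n) y, ord_pred y \notin B
              & forall i, i <= k -> iter i (@ordS n) y \in B].
Proof.
elim: k x => [|k IHk] x /= /andP[Bx].
  by move=> npx; exists x; split => // -[].
case/IHk=> y [px npy By]; exists y; rewrite -px ord_predK; split=> // i.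
by rewrite leq_eqVlt ltnS => /predU1P[->|/By//]; rewrite /= -px ord_predK.
Qed.

(** The elements j_2, j_4, ... have odd zero-based indices. Conversely, the chain through [x] is
    rebuilt by going forward from its start until [B] is left. *)
Lemma removedP n (B : {set 'I_n}) x : B != setT ->
  reflect (exists2 k, odd k & offset B k x) (x \in removed B).
Proof.
move=> nBT; rewrite inE; apply: (iffP existsP) => [[t]|[k odd_k]].
  case/existsP=> j /and3P[_ mxj /existsP[k /and3P[odd_k _ /eqP->]]].
  rewrite negbK in odd_k; exists k => //.
  by rewrite (tnth_nth x) max_chain_offset // size_tuple.
case/offset_chain=> y [xE npy By].
have exit : exists t, iter t (@ordS n) y \notin B.
  have /subsetPn[z _ nBz] : ~~ ([set: 'I_n] \subset B) by rewrite subTset.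
  by have [i iyz] := iter_ordS_reach y z; exists i; rewrite iyz.
(* The first exit time [t] is the length of the maximal chain starting at [y]. *)
case: (ex_minnP exit) => t nyt mint.
have ltkt : k < t by rewrite ltnNge; apply: contra nyt; exact: By.
have uniq_t : uniq (traject (@ordS n) y t).
  (* A repetition before the exit would make the exit point occur at an earlier time, against the
     minimality of [t]. *)
  case: t nyt mint {ltkt} => // t nyt mint.
  rewrite looping_uniq; apply/negP => /trajectP[i ltit].
  move/(congr1 (@ordS n)); rewrite -!iterS => eqit.
  by rewrite eqit in nyt; have := mint _ nyt; rewrite ltnNge ltit.
have Bt : all (fun z => z \in B) (traject (@ordS n) y t).
  apply/allP => z /trajectP[i ltit ->]; apply: contraLR ltit => nyi.
  by rewrite -leqNgt mint.
have ltn : t < n.+1.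
  rewrite ltnS -[t](size_traject (@ordS n) y) -(card_uniqP uniq_t).
  by rewrite -[leqRHS]card_ord max_card.
exists (Ordinal ltn); apply/existsP.
have szt : size (traject (@ordS n) y t) == t by rewrite size_traject.
exists (Tuple szt); apply/and3P; split => /=.
- by case: k odd_k ltkt {xE By} => // k _; apply: leq_ltn_trans.
- rewrite /is_max_chain /is_chain uniq_t Bt sorted_cprec.
  case: t {mint ltn szt} nyt ltkt uniq_t Bt => // t nyt _ uniq_t Bt.
  rewrite [sorted _ _]fpath_traject /=; apply/forallP => a; apply/andP; split.
    apply/negP => /and3P[/= /andP[+ _] _ /andP[Ba _]].
    by rewrite cprecE => /eqP Say; rewrite -[a]ordSK Say (negPf npy) in Ba.
  apply/negP => /and3P[/= pth _ /andP[_ Bsa]]; move: pth Bsa.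
  rewrite rcons_path last_traject all_rcons cprecE => /andP[_ /eqP <-].
  by rewrite -iterS (negPf nyt).
- apply/existsP; exists (Ordinal ltkt); rewrite /= negbK odd_k.
  rewrite (tnth_nth y) /= nth_traject // -xE eqxx andbT /gamma.
  (* When [t] is odd, the even number [k.+1] differs from [t], so it is at most [t.-1]. *)
  case: ifP => // odd_t; rewrite -ltnS (ltn_predK ltkt) ltn_neqAle.
  by rewrite ltkt andbT; apply: contraTneq odd_t => <-; rewrite /= odd_k.
Qed.

(** A step forward inside [B] raises the offset by one and so flips its parity. *)
Lemma mem_removed n (B : {set 'I_n}) x : B != setT ->
  (x \in removed B) =
  [&& x \in B, ord_pred x \in B & ord_pred x \notin removed B].
Proof.
move=> nBT; apply/(removedP _ nBT)/and3P.
  case=> -[//|k] /= odd_k /andP[Bx ox]; split=> //; first exact: offset_in ox.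
  apply/(removedP _ nBT) => -[l odd_l /(offset_uniq ox) ekl].
  by rewrite ekl odd_l in odd_k.
case=> Bx Bpx npx; have [k ok] := offset_ex nBT Bpx.
exists k.+1; rewrite /= ?Bx //.
by apply: contra npx => odd_k; apply/(removedP _ nBT); exists k.
Qed.

(** Induction on the offset: at 0 both sides exclude [x], and afterwards membership of the
    predecessor decides. *)
Lemma removed_unique n (B Q : {set 'I_n}) : B != setT ->
  (forall x, (x \in Q) = [&& x \in B, ord_pred x \in B & ord_pred x \notin Q]) ->
  removed B = Q.
Proof.
move=> nBT memQ; apply/setP => x.
have [Bx|nBx] := boolP (x \in B); last first.
  by rewrite memQ mem_removed // (negPf nBx).
have [k] := offset_ex nBT Bx; elim: k x {Bx} => [|k IHk] x /= /andP[Bx ok].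
  by rewrite memQ mem_removed // (negPf ok) andbF.
by rewrite memQ mem_removed // IHk.
Qed.

(** * Blocks of ordered set partitions and the optional last block *)

Lemma mem_bigcup_seq n (I : eqType) (s : seq I) (F : I -> {set 'I_n}) x :
  (x \in \bigcup_(i <- s) F i) = has (fun i => x \in F i) s.
Proof. by elim: s => [|i s IHs] /=; rewrite ?big_nil ?big_cons inE ?IHs. Qed.

Lemma no_cyc_adjP n (s : seq {set 'I_n}) :
  reflect {in s, forall (B : {set 'I_n}) x, x \in B -> ord_pred x \notin B}
          (no_cyc_adj s).
Proof.
apply: (iffP allP) => adj B sB => [x Bx|].
  apply/negP => Bpx; have /forall_inP/(_ _ Bpx)/forall_inP/(_ _ Bx) := adj B sB.
  by rewrite cprecE ord_predK eqxx.
apply/forall_inP => a Ba; apply/forall_inP => b Bb; rewrite cprecE.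
by apply: contraL Ba => /eqP Sab; rewrite -[a]ordSK Sab adj.
Qed.

Lemma eq_block n (s : seq {set 'I_n}) B C x :
  pairwise (fun A B : {set 'I_n} => [disjoint A & B]) s ->
  B \in s -> C \in s -> x \in B -> x \in C -> B = C.
Proof.
move=> dj sB sC Bx Cx; elim: s dj sB sC => //= A s IHs /andP[/allP djA djs].
rewrite !inE => /predU1P[BA|sB] /predU1P[CA|sC]; last exact: IHs.
- by rewrite BA.
- by rewrite BA in Bx; rewrite (disjointFr (djA _ sC) Bx) in Cx.
- by rewrite CA in Cx; rewrite (disjointFr (djA _ sB) Cx) in Bx.
Qed.

(** Any block disjoint from the whole circle is empty, so a full block would be the only one, and
    one is odd. *)
Lemma Lset_proper n (s : seq {set 'I_n}) B :
  s \in @Lset n -> B \in s -> B != setT.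
Proof.
case/andP=> /and3P[s0 dj _] even_s sB; apply: contra even_s => /eqP BT.
case/splitPr: sB s0 dj => s1 s2; rewrite BT {BT B}.
rewrite pairwise_cat allrel_consr /= mem_cat inE !negb_or.
case/and3P=> s1_0 _ s2_0 /and3P[/andP[/allP d1 _] _ /andP[/allP d2 _]].
case: s1 => [|A s1] in s1_0 d1 *; last first.
  have := d1 A (mem_head _ _); rewrite disjoint_sym -setI_eq0 setTI => /eqP A0.
  by rewrite A0 mem_head in s1_0.
case: s2 => [//|A s2] in s2_0 d2 *.
have := d2 A (mem_head _ _); rewrite -setI_eq0 setTI => /eqP A0.
by rewrite A0 mem_head in s2_0.
Qed.

(** An empty [R] encodes the absence of a last block. *)
Definition attach n (t : seq {set 'I_n}) (R : {set 'I_n}) :=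
  if R == set0 then t else rcons t R.

Lemma attach_inj n (t t' : seq {set 'I_n}) R R' :
  ~~ odd (size t) -> ~~ odd (size t') -> attach t R = attach t' R' ->
  t = t' /\ R = R'.
Proof.
rewrite /attach => et et'; have [->|_] := eqVneq R; have [->|_] := eqVneq R' => //.
- by move=> tE; rewrite tE size_rcons /= et' in et.
- by move=> tE; rewrite -tE size_rcons /= et in et'.
- by case/rcons_inj.
Qed.

Lemma attach_surj n (u : seq {set 'I_n}) : set0 \notin u ->
  exists t R, u = attach t R /\ ~~ odd (size t).
Proof.
move=> u0; have [|even_u] := boolP (odd (size u)); last first.
  by exists u, set0; rewrite /attach eqxx.
case/lastP: u u0 => // t R; rewrite size_rcons mem_rcons inE negb_or.
by case/andP=> R0 _ /= even_t; exists t, R; rewrite /attach eq_sym (negPf R0).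
Qed.

Lemma is_osp_attach n (t : seq {set 'I_n}) R :
  is_osp (attach t R) =
  [&& set0 \notin t, pairwise (fun A B : {set 'I_n} => [disjoint A & B]) t,
      all (fun B : {set 'I_n} => [disjoint B & R]) t
    & \bigcup_(A <- t) A :|: R == [set: 'I_n]].
Proof.
rewrite /is_osp /attach; have [->|R0] := eqVneq R.
  by rewrite setU0 (@eq_all _ _ predT) ?all_predT // => B; rewrite -setI_eq0 setI0 eqxx.
rewrite mem_rcons inE negb_or eq_sym R0 pairwise_rcons big_rcons /=.
by case: (all _ t); rewrite ?andbF.
Qed.

Lemma no_cyc_adj_attach n (t : seq {set 'I_n}) R :
  no_cyc_adj (attach t R) = no_cyc_adj t && no_cyc_adj [:: R].
Proof.
rewrite /attach /no_cyc_adj; have [->|_] := eqVneq R; last first.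
  by rewrite all_rcons /= andbT andbC.
by rewrite /= andbT [X in _ && X](_ : _ = true) ?andbT //;
   apply/'forall_implyP => a; rewrite inE.
Qed.

(** * The map [lambda] and its inverse *)

Lemma lambdaE n (s : seq {set 'I_n}) :
  lambda s = attach [seq B :\: removed B | B <- s] (\bigcup_(B <- s) removed B).
Proof. by []. Qed.

Lemma lambda_Oset n (s : seq {set 'I_n}) : s \in @Lset n -> lambda s \in @Oset n.
Proof.
move=> Ls; have memR B x sB := mem_removed x (Lset_proper Ls (B := B) sB).
have /andP[/and3P[s0 dj /eqP cov] _] := Ls.
have subR B x : B \in s -> x \in removed B -> x \in B.
  by move=> sB; rewrite memR // => /and3P[].
rewrite unfold_in /Oset lambdaE is_osp_attach no_cyc_adj_attach.
apply/andP; split; [apply/and4P; split|apply/andP; split].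
(* If all of [B] were removed, some removed element would have a removed predecessor, against the
   recursion. *)
- apply/mapP => -[B sB /esym BR].
  have /set0Pn[x Bx] : B != set0 by apply: contraNneq s0 => <-.
  have nB z : z \in B -> z \in removed B.
    by move=> Bz; have := in_set0 z; rewrite -BR inE Bz andbT => /negbFE.
  by have := nB _ Bx; rewrite memR // => /and3P[_ /nB ->].
- rewrite pairwise_map; apply: sub_pairwise dj => A B /=.
  by move=> dAB; rewrite (disjointWl (subsetDl _ _)) ?(disjointWr (subsetDl _ _)).
- apply/allP => _ /mapP[B sB ->]; apply/pred0P => x /=; rewrite inE.
  rewrite mem_bigcup_seq; apply/negP => /andP[/andP[nx Bx] /hasP[C sC Cx]].
  have eBC := eq_block dj sB sC Bx (subR _ _ sC Cx).
  by rewrite eBC Cx in nx.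
- apply/eqP/setP => x; rewrite big_map [RHS]inE in_setU !mem_bigcup_seq -has_predU.
  have : x \in [set: 'I_n] by [].
  rewrite -cov mem_bigcup_seq => /hasP[B sB Bx].
  by apply/hasP; exists B; rewrite //= inE Bx andbT orNb.
- apply/no_cyc_adjP => _ /mapP[B sB ->] x; rewrite !in_setD => /andP[nx Bx].
  by apply: contra nx => /andP[npx Bpx]; rewrite memR // Bx Bpx.
(* The predecessor of a removed element is kept in its block [B], and it lies in no other block from
   which it could be removed. *)
- apply/no_cyc_adjP => _ /predU1P[->|//] x; rewrite !mem_bigcup_seq.
  case/hasP=> B sB /=; rewrite memR // => /and3P[Bx Bpx npx].
  apply/hasP => -[C sC Cpx].
  by have eBC := eq_block dj sB sC Bpx (subR _ _ sC Cpx); rewrite eBC Cpx in npx.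
Qed.

(* Undoes the removal: an element of R came from the block of its predecessor. *)
Definition absorb n (R B : {set 'I_n}) :=
  B :|: [set x in R | ord_pred x \in B].

Lemma mem_absorb n (R B : {set 'I_n}) x :
  (x \in absorb R B) = (x \in B) || (x \in R) && (ord_pred x \in B).
Proof. by rewrite !inE. Qed.

Lemma absorb_lambda n (s : seq {set 'I_n}) : s \in @Lset n ->
  map (absorb (\bigcup_(B <- s) removed B)) [seq B :\: removed B | B <- s] = s.
Proof.
move=> Ls; have memR B x sB := mem_removed x (Lset_proper Ls (B := B) sB).
have /andP[/and3P[_ dj _] _] := Ls.
rewrite -map_comp; apply: map_id_in => B sB; apply/setP => x /=.
rewrite mem_absorb !in_setD mem_bigcup_seq; apply/idP/idP.
  case/orP=> [/andP[]//|/andP[/hasP[C sC Cx] /andP[_ Bpx]]].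
  (* An element removed from [C] has its predecessor in [C]; that predecessor is also in [B], so the
     two blocks agree. *)
  move: Cx; rewrite memR // => /and3P[Cx Cpx _].
  by rewrite (eq_block dj sB sC Bpx Cpx).
move=> Bx; rewrite Bx andbT; have [Rx|//] := boolP (x \in removed B).
have := Rx; rewrite memR // => /and3P[_ -> ->]; rewrite /= andbT.
by apply/hasP; exists B.
Qed.

Lemma lambda_inj n : {in @Lset n &, injective (@lambda n)}.
Proof.
move=> s s' Ls Ls'; rewrite !lambdaE => /attach_inj[].
- by rewrite size_map; case/andP: Ls.
- by rewrite size_map; case/andP: Ls'.
by move=> et eR; rewrite -(absorb_lambda Ls) et eR absorb_lambda.
Qed.

(** The moved elements satisfy the recursion of [removed_unique]: an [x] in [B] has its predecessor
    outside [B], while a moved [x] has its predecessor in [B], hence not among the moved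
    elements. *)
Lemma removed_absorb n (R B : {set 'I_n}) :
    [disjoint B & R] -> no_cyc_adj [:: B; R] -> absorb R B != setT ->
  removed (absorb R B) = [set x in R | ord_pred x \in B].
Proof.
move=> dBR /no_cyc_adjP adj nBT; apply: removed_unique => // x; rewrite !inE.
have adjB : x \in B -> ord_pred x \notin B by apply: adj; rewrite mem_head.
have adjR : x \in R -> ord_pred x \notin R by apply: adj; rewrite !inE eqxx orbT.
have := disjointFr dBR (x := x); move: adjB adjR.
case: (x \in B) (x \in R) (ord_pred x \in B) (ord_pred x \in R) => [] [] [] [];
  do ?[by case: (_ \in B) | by move=> /(_ isT) | by move=> _ /(_ isT)
      | by move=> _ _ /(_ isT)].
Qed.

Lemma lambda_surj n (u : seq {set 'I_n}) : u \in @Oset n ->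
  exists2 s, s \in @Lset n & lambda s = u.
Proof.
case/andP=> osp_u adj_u; have /and3P[u0 _ _] := osp_u.
have [t [R [uE even_t]]] := attach_surj u0.
move: osp_u adj_u; rewrite uE is_osp_attach no_cyc_adj_attach.
case/and4P=> t0 dj /allP dR /eqP cov /andP[/no_cyc_adjP adjt /no_cyc_adjP adjR].
have {}adjR x : x \in R -> ord_pred x \notin R by apply: adjR; rewrite inE.
have in_block x : x \notin R -> exists2 B, B \in t & x \in B.
  move=> nRx; have : x \in [set: 'I_n] by [].
  by rewrite -cov inE (negPf nRx) orbF mem_bigcup_seq => /hasP.
pose s := map (absorb R) t.
(* This comes first because it makes the enlarged blocks proper, as [removed_absorb] requires. *)
have Ls : s \in @Lset n.
  rewrite unfold_in /Lset /is_osp size_map even_t andbT; apply/and3P; split.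
  - apply/mapP => -[B tB /esym/eqP]; rewrite setU_eq0 => /andP[/eqP B0 _].
    by rewrite -B0 tB in t0.
  - rewrite pairwise_map; apply: (sub_in_pairwise (P := mem t)) dj; last exact/allP.
    move=> A B tA tB /= dAB; apply/pred0P => x /=; rewrite !inE; apply/negP.
    case/andP=> /orP[Ax|/andP[Rx Apx]] /orP[Bx|/andP[Rx' Bpx]].
    + by rewrite (disjointFr dAB Ax) in Bx.
    + by rewrite (disjointFr (dR _ tA) Ax) in Rx'.
    + by rewrite (disjointFr (dR _ tB) Bx) in Rx.
    + by rewrite (disjointFr dAB Apx) in Bpx.
  - apply/eqP/setP => x; rewrite inE big_map mem_bigcup_seq; apply/hasP.
    have [Rx|/in_block[B tB Bx]] := boolP (x \in R); last first.
      by exists B; rewrite // !inE Bx.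
    (* As [R] has no adjacencies, the predecessor of [x] lies in some [B], whose enlargement takes
       in [x]. *)
    have [B tB Bpx] := in_block _ (adjR _ Rx).
    by exists B; rewrite // !inE Rx Bpx orbT.
have remE B : B \in t ->
    removed (absorb R B) = [set x in R | ord_pred x \in B].
  move=> tB; apply: removed_absorb; first exact: dR.
    apply/no_cyc_adjP => C; rewrite !inE => /orP[]/eqP-> //; exact: adjt.
  by apply: (Lset_proper Ls); apply: map_f.
exists s => //; rewrite lambdaE big_map; congr attach.
  rewrite -map_comp; apply: map_id_in => B tB /=; rewrite remE //.
  apply/setP => x; rewrite !inE; have [Bx|] := boolP (x \in B).
    by rewrite (disjointFr (dR _ tB) Bx).
  by rewrite orFb andNb.
apply/setP => x; rewrite mem_bigcup_seq; apply/hasP/idP.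
  by case=> B tB; rewrite remE // inE => /andP[].
move=> Rx; have [B tB Bpx] := in_block _ (adjR _ Rx).
by exists B; rewrite // remE // inE Rx.
Qed.

Theorem theorem3p13 (n : nat) (n_gt0 : 0 < n) :
  [/\ forall s : seq {set 'I_n}, s \in @Lset n -> lambda s \in @Oset n,
      {in @Lset n &, injective (@lambda n)}
    & forall u : seq {set 'I_n}, u \in @Oset n ->
        exists2 s : seq {set 'I_n}, s \in @Lset n & lambda s = u].
Proof.
split; [exact: lambda_Oset | exact: lambda_inj | exact: lambda_surj].
Qed.
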